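(* Let $H$ be a Hopf algebra over a field $\Bbbk$ with bijective antipode $S$ and let $(A,\rho_A)$ be a right $H$-comodule algebra. Then the map $\underline{B}:H\otimes H\to A\otimes H^{\mathrm{op}}$, $\underline{B}(h\otimes h')=1_A\otimes h'S^{-1}(h)$ (product in $H$), is a normalized Casimir morphism for $(H,\psi)$ satisfying the h-coseparability condition; equivalently, the map $\underline{\mathfrak{T}}:H\to A\otimes H^{\mathrm{op}}$, $\underline{\mathfrak{T}}(h)=1_A\otimes S^{-1}(h)$, is a total integral on $(H,\psi)$ satisfying the h-property. Therefore the cowreath $(A\otimes H^{\mathrm{op}},H,\psi)$ is h-separable.
   Context: Everything is over a field $\Bbbk$, $\otimes=\otimes_{\Bbbk}$, and Sweedler notation with suppressed summation is used. $H$ is a Hopf algebra with counit $\varepsilon$ and antipode $S$; $H^{\mathrm{op}}$ is $H$ with opposite multiplication. A right $H$-comodule algebra $(A,\rho_A)$ is a unital associative algebra $A$ which is a right $H$-comodule via an algebra map $\rho_A:A\to A\otimes H$, $\rho_A(a)=a_0\otimes a_1$ (iterated: $a_0\otimes a_1\otimes a_2$, etc.). With $\psi:H\otimes A\otimes H^{\mathrm{op}}\to A\otimes H^{\mathrm{op}}\otimes H$, $\psi(h\otimes a\otimes l)=a_0\otimes l_1\otimes l_2ha_1$, one has a cowreath $(A\otimes H^{\mathrm{op}},H,\psi)$. Convention: whenever a multiplication symbol is omitted, products in $A\otimes H$ are computed with the ordinary multiplications of $A$ and of $H$ (not the opposite one). A Casimir morphism for $(H,\psi)$ is a $\Bbbk$-linear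 map $B:H\otimes H\to A\otimes H^{\mathrm{op}}$, written $B(h\otimes h')=B^A(h\otimes h')\otimes B^H(h\otimes h')$, such that for all $a\in A$, $g,h,h'\in H$: $$(a_0\otimes 1_H)B(g_2ha_1\otimes g_3h'a_2)(1_A\otimes g_1)=(1_A\otimes g)B(h\otimes h')(a\otimes 1_H),$$ $$B^A(h_2\otimes h')_0\otimes B^H(h_2\otimes h')_1\otimes B^H(h_2\otimes h')_2h_1B^A(h_2\otimes h')_1=B(h\otimes h'_1)\otimes h'_2.$$ It is normalized if $B(h_1\otimes h_2)=\varepsilon(h)1_A\otimes 1_H$ for all $h\in H$. It satisfies the h-coseparability condition if for all $h,h',h''\in H$ $$B^A(h\otimes h'_1)B^A(h'_2\otimes h'')\otimes B^H(h'_2\otimes h'')B^H(h\otimes h'_1)=\varepsilon(h')B(h\otimes h'').$$ The cowreath $(A\otimes H^{\mathrm{op}},H,\psi)$ is h-separable if there is a normalized Casimir morphism for $(H,\psi)$ satisfying the h-coseparability condition. An integral on $(H,\psi)$ is a $\Bbbk$-linear map $\mathfrak{T}:H\to A\otimes H^{\mathrm{op}}$, written $\mathfrak{T}(h)=\mathfrak{T}^A(h)\otimes \mathfrak{T}^H(h)$, such that for all $a\in A$, $h\in H$: $$\mathfrak{T}^A(h_2)_0\otimes \mathfrak{T}^H(h_2)_1\otimes \mathfrak{T}^H(h_2)_2h_1\mathfrak{T}^A(h_2)_1=\mathfrak{T}(h)\otimes 1_H,$$ $$(a_0\otimes 1_H)\mathfrak{T}(S^{-1}(a_2)ha_1)(1_A\otimes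 S^{-1}(a_3))=(1_A\otimes S^{-1}(a_1))\mathfrak{T}(h)(a_0\otimes 1_H).$$ It is total if $\mathfrak{T}(1_H)=1_A\otimes 1_H$. A total integral satisfies the h-property if $(\mathrm{Id}_A\otimes\varepsilon)(\mathfrak{T}(h)\mathfrak{T}(h'))=(\mathrm{Id}_A\otimes\varepsilon)(\mathfrak{T}(h'h))$ for all $h,h'\in H$. (''Equivalently'' refers to the correspondence $B\mapsto B(-\otimes 1_H)$ between Casimir morphisms and integrals.) *)

(* Defs.v *)
(* [boolp] is used only to turn the congruence defining the tensor product
   into a boolean relation. *)
From HB Require Import structures.
From mathcomp Require Import all_boot all_order all_algebra.
From mathcomp Require Import boolp.

Set Implicit Arguments.
Unset Strict Implicit.
Unset Printing Implicit Defensive.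

Import GRing.Theory.

Local Open Scope ring_scope.
Local Open Scope quotient_scope.

Reserved Notation "U ⊗ V" (at level 45, left associativity).
Reserved Notation "\tsum_ ( x , y <- t ) E"
  (at level 41, E at level 41, x name, y name, t at level 50,
   format "'[' \tsum_ ( x ,  y  <-  t ) '/  '  E ']'").
Reserved Notation "\tsum_ ( x , y , z <- t ) E"
  (at level 41, E at level 41, x name, y name, z name, t at level 50,
   format "'[' \tsum_ ( x ,  y ,  z  <-  t ) '/  '  E ']'").
Reserved Notation "\tsum_ ( x , y , z , w <- t ) E"
  (at level 41, E at level 41, x name, y name, z name, w name, t at level 50,
   format "'[' \tsum_ ( x ,  y ,  z ,  w  <-  t ) '/  '  E ']'").

(* Tensor product of vector spaces by generators and relations: a sequence
   [:: (u1, v1); ..; (un, vn)] stands for the sum of the ui ⊗ vi (a scalar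
   being absorbed in the first component), and [tens_eq] is the congruence
   generated by bilinearity. *)
Section TensorSpace.
Variables (K : fieldType) (U V : lmodType K).

Inductive tens_eq : seq (U * V) -> seq (U * V) -> Prop :=
| TensRefl s : tens_eq s s
| TensSym s t : tens_eq s t -> tens_eq t s
| TensTrans s t r : tens_eq s t -> tens_eq t r -> tens_eq s r
| TensCat s s' t t' : tens_eq s s' -> tens_eq t t' ->
    tens_eq (s ++ t) (s' ++ t')
| TensCatC s t : tens_eq (s ++ t) (t ++ s)
| TensNull v : tens_eq [:: (0, v)] [::]
| TensDl u u' v : tens_eq [:: (u + u', v)] [:: (u, v); (u', v)]
| TensDr u v v' : tens_eq [:: (u, v + v')] [:: (u, v); (u, v')]
| TensZ (c : K) u v : tens_eq [:: (c *: u, v)] [:: (u, c *: v)].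

Definition tens_eqb (s t : seq (U * V)) : bool := `[< tens_eq s t >].

Lemma tens_eqb_refl : reflexive tens_eqb.
Proof. by move=> s; apply/asboolP; exact: TensRefl. Qed.

Lemma tens_eqb_sym : symmetric tens_eqb.
Proof. by move=> s t; apply/asboolP/asboolP => /TensSym. Qed.

Lemma tens_eqb_trans : transitive tens_eqb.
Proof.
by move=> t s r /asboolP st /asboolP tr; apply/asboolP; exact: TensTrans st tr.
Qed.

Canonical tens_equiv :=
  EquivRel tens_eqb tens_eqb_refl tens_eqb_sym tens_eqb_trans.

Definition tens : Type := {eq_quot tens_equiv}.

HB.instance Definition _ := Choice.on tens.

Definition tens_pi (s : seq (U * V)) : tens := \pi_({eq_quot tens_equiv}) s.
Definition tens_repr (x : tens) : seq (U * V) :=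
  repr (x : {eq_quot tens_equiv}).

Lemma tens_reprK : cancel tens_repr tens_pi.
Proof. exact: reprK. Qed.

Lemma tens_pi_eq (s t : seq (U * V)) : tens_eq s t -> tens_pi s = tens_pi t.
Proof. by move=> st; apply/eqmodP/asboolP. Qed.

Lemma tens_repr_pi (s : seq (U * V)) : tens_eq (tens_repr (tens_pi s)) s.
Proof.
have /eqmodP/asboolP // : tens_repr (tens_pi s) = s %[mod_eq tens_equiv].
exact: tens_reprK.
Qed.

Fact tens_piW (P : tens -> Prop) : (forall s, P (tens_pi s)) -> forall x, P x.
Proof. by move=> Ppi x; rewrite -[x]tens_reprK. Qed.

Definition tpure (u : U) (v : V) : tens := tens_pi [:: (u, v)].

Definition tens_zero : tens := tens_pi [::].
Definition tens_add (x y : tens) : tens := tens_pi (tens_repr x ++ tens_repr y).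
Definition tens_scale (c : K) (x : tens) : tens :=
  tens_pi [seq (c *: p.1, p.2) | p <- tens_repr x].

Lemma tens_addE s t :
  tens_add (tens_pi s) (tens_pi t) = tens_pi (s ++ t).
Proof. by apply: tens_pi_eq; apply: TensCat; exact: tens_repr_pi. Qed.

Lemma tens_eq_scale (c : K) s t : tens_eq s t ->
  tens_eq [seq (c *: p.1, p.2) | p <- s] [seq (c *: p.1, p.2) | p <- t].
Proof.
elim=> {s t} [s|s t _|s t r _ st _ tr|s s' t t' _ ss' _ tt'|s t|v|u u' v|u v v'
             |d u v] /=.
- exact: TensRefl.
- exact: TensSym.
- exact: TensTrans st tr.
- by rewrite !map_cat; exact: TensCat.
- by rewrite !map_cat; exact: TensCatC.
- by rewrite scaler0; exact: TensNull.
- by rewrite scalerDr; exact: TensDl.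
- exact: TensDr.
- by rewrite scalerA mulrC -scalerA; exact: TensZ.
Qed.

Lemma tens_scaleE c s :
  tens_scale c (tens_pi s) = tens_pi [seq (c *: p.1, p.2) | p <- s].
Proof.
by apply: tens_pi_eq; apply: tens_eq_scale; exact: tens_repr_pi.
Qed.

Fact tens_addA : associative tens_add.
Proof.
elim/tens_piW=> x; elim/tens_piW=> y; elim/tens_piW=> z.
by rewrite !tens_addE catA.
Qed.

Fact tens_addC : commutative tens_add.
Proof.
elim/tens_piW=> x; elim/tens_piW=> y; rewrite !tens_addE.
by apply: tens_pi_eq; exact: TensCatC.
Qed.

Fact tens_add0 : left_id tens_zero tens_add.
Proof. by elim/tens_piW=> x; rewrite tens_addE. Qed.

HB.instance Definition _ :=
  GRing.isNmodule.Build tens tens_addA tens_addC tens_add0.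

Lemma tens_ind (P : tens -> Prop) :
  P 0 -> (forall u v x, P x -> P (tpure u v + x)) -> forall x, P x.
Proof.
move=> P0 PD x; rewrite -[x]tens_reprK; elim: (tens_repr x) => [|[u v] s Ps] //.
rewrite -cat1s (_ : tens_pi _ = tpure u v + tens_pi s); first exact: PD.
by rewrite [RHS]tens_addE.
Qed.

Lemma tpureDl u u' v : tpure (u + u') v = tpure u v + tpure u' v.
Proof. by rewrite [RHS]tens_addE; apply: tens_pi_eq; exact: TensDl. Qed.

Lemma tpureDr u v v' : tpure u (v + v') = tpure u v + tpure u v'.
Proof. by rewrite [RHS]tens_addE; apply: tens_pi_eq; exact: TensDr. Qed.

Lemma tpure0l v : tpure 0 v = 0.
Proof. by apply: tens_pi_eq; exact: TensNull. Qed.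

Fact tens_scale_pure c u v : tens_scale c (tpure u v) = tpure (c *: u) v.
Proof. exact: tens_scaleE. Qed.

Fact tens_scale0 c : tens_scale c 0 = 0.
Proof. exact: tens_scaleE. Qed.

Fact tens_scaleDr : right_distributive tens_scale +%R.
Proof.
move=> c; elim/tens_piW=> x; elim/tens_piW=> y; rewrite [_ + _]tens_addE.
by rewrite !tens_scaleE map_cat -tens_addE.
Qed.

Fact tens_addN : left_inverse 0 (tens_scale (-1)) +%R.
Proof.
elim/tens_ind=> [|u v x IHx]; first by rewrite tens_scale0 addr0.
rewrite tens_scaleDr addrACA IHx tens_scale_pure -tpureDl scaleN1r addNr.
by rewrite tpure0l addr0.
Qed.

HB.instance Definition _ := GRing.Nmodule_isZmodule.Build tens tens_addN.

Fact tens_scaleA a b (x : tens) :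
  tens_scale a (tens_scale b x) = tens_scale (a * b) x.
Proof.
elim/tens_ind: x => [|u v x IHx]; first by rewrite !tens_scale0.
by rewrite !tens_scaleDr IHx !tens_scale_pure scalerA.
Qed.

Fact tens_scale1 : left_id 1 tens_scale.
Proof.
elim/tens_ind=> [|u v x IHx]; first by rewrite tens_scale0.
by rewrite tens_scaleDr IHx tens_scale_pure scale1r.
Qed.

Fact tens_scaleDl (x : tens) : {morph tens_scale^~ x : a b / a + b}.
Proof.
move=> a b; elim/tens_ind: x => [|u v x IHx].
  by rewrite !tens_scale0 addr0.
by rewrite !tens_scaleDr IHx !tens_scale_pure scalerDl tpureDl addrACA.
Qed.

HB.instance Definition _ := GRing.Zmodule_isLmodule.Build K tens
  tens_scaleA tens_scale1 tens_scaleDr tens_scaleDl.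

Lemma tpure_bilinear : bilinear_for *:%R *:%R tpure.
Proof.
split=> [v c u u'|u c v v'].
  by rewrite /= tpureDl; congr (_ + _); rewrite [RHS]tens_scale_pure.
rewrite /= tpureDr; congr (_ + _); rewrite [RHS]tens_scale_pure.
by apply/esym/tens_pi_eq; exact: TensZ.
Qed.

(* Sweedler summation: [tsum t f] is the sum of the [f u v] over a chosen
   representation of [t] as a sum of pure tensors.  It is meaningful only for
   bilinear [f], in which case it is the linear map induced by [f]
   ([tsum_pure], [tsum_linear]). *)
Definition tsum (t : tens) (W : zmodType) (f : U -> V -> W) : W :=
  \sum_(p <- tens_repr t) f p.1 p.2.

Lemma eq_tsum (W : zmodType) (f g : U -> V -> W) t :
  f =2 g -> tsum t f = tsum t g.
Proof. by move=> fg; apply: eq_bigr => p _; exact: fg. Qed.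

Lemma tsum_comb (W : lmodType K) (c : K) (f g : U -> V -> W) t :
  tsum t (fun u v => c *: f u v + g u v) = c *: tsum t f + tsum t g.
Proof. by rewrite /tsum scaler_sumr -big_split. Qed.

Section Universal.
Variables (W : lmodType K) (f : U -> V -> W).
Hypothesis f_bil : bilinear_for *:%R *:%R f.

Fact bilDl u u' v : f (u + u') v = f u v + f u' v.
Proof. by have := f_bil.1 v 1 u u'; rewrite /= !scale1r. Qed.

Fact bilDr u v v' : f u (v + v') = f u v + f u v'.
Proof. by have := f_bil.2 u 1 v v'; rewrite /= !scale1r. Qed.

Fact bil0l v : f 0 v = 0.
Proof. by apply: (addrI (f 0 v)); rewrite -bilDl !addr0. Qed.

Fact bil0r u : f u 0 = 0.
Proof. by apply: (addrI (f u 0)); rewrite -bilDr !addr0. Qed.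

Fact bilZl c u v : f (c *: u) v = c *: f u v.
Proof. by have := f_bil.1 v c u 0; rewrite /= bil0l !addr0. Qed.

Fact bilZr c u v : f u (c *: v) = c *: f u v.
Proof. by have := f_bil.2 u c v 0; rewrite /= bil0r !addr0. Qed.

Fact tens_eq_sum s t : tens_eq s t ->
  \sum_(p <- s) f p.1 p.2 = \sum_(p <- t) f p.1 p.2.
Proof.
elim=> {s t} [s|s t _|s t r _ st _ tr|s s' t t' _ ss' _ tt'|s t|v|u u' v|u v v'
             |c u v] //=.
- by rewrite st.
- by rewrite !big_cat /= ss' tt'.
- by rewrite !big_cat /= addrC.
- by rewrite big_seq1 big_nil /= bil0l.
- by rewrite !big_cons !big_nil /= !addr0 bilDl.
- by rewrite !big_cons !big_nil /= !addr0 bilDr.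
- by rewrite !big_seq1 /= bilZl bilZr.
Qed.

Lemma tsum_pi s : tsum (tens_pi s) f = \sum_(p <- s) f p.1 p.2.
Proof. exact/tens_eq_sum/tens_repr_pi. Qed.

Lemma tsum_pure u v : tsum (tpure u v) f = f u v.
Proof. by rewrite tsum_pi big_seq1. Qed.

Lemma tsum_linear : linear (fun t => tsum t f).
Proof.
move=> c; elim/tens_piW=> x; elim/tens_piW=> y.
rewrite [c *: _]tens_scaleE [_ + _]tens_addE !tsum_pi big_cat big_map /=.
by congr (_ + _); rewrite scaler_sumr; apply: eq_bigr => p _; rewrite bilZl.
Qed.
End Universal.

End TensorSpace.

Arguments tens {K} (U V)%_type_scope.

Notation "U ⊗ V" := (tens U V) : type_scope.
Notation "u ⊗ v" := (tpure u v) : ring_scope.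
Notation "\tsum_ ( x , y <- t ) E" := (tsum t (fun x y => E)) : ring_scope.
Notation "\tsum_ ( x , y , z <- t ) E" :=
  (tsum t (fun xy z => tsum xy (fun x y => E))) : ring_scope.
Notation "\tsum_ ( x , y , z , w <- t ) E" :=
  (tsum t (fun xyz w => tsum xyz (fun xy z => tsum xy (fun x y => E))))
  : ring_scope.

(* A unital associative algebra over K is a vector space with a bilinear
   associative product and a unit.  MathComp's [algType K] is not used because
   it excludes the zero algebra, which is a legitimate comodule algebra. *)
HB.mixin Record isUnitalAlgebra (K : fieldType) A of GRing.Lmodule K A := {
  ualg_one : A;
  ualg_mul : A -> A -> A;
  ualg_mulA : associative ualg_mul;
  ualg_mul1l : left_id ualg_one ualg_mul;
  ualg_mul1r : right_id ualg_one ualg_mul;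
  ualg_mul_bilinear : bilinear_for *:%R *:%R ualg_mul;
}.

#[short(type="ualgType")]
HB.structure Definition UnitalAlgebra (K : fieldType) :=
  { A of isUnitalAlgebra K A & GRing.Lmodule K A }.

Section UnitalAlgebraRing.
Variables (K : fieldType) (A : ualgType K).

Fact ualg_mulDl : left_distributive (@ualg_mul K A) +%R.
Proof. by move=> a b c; exact: (bilDl (@ualg_mul_bilinear K A)). Qed.

Fact ualg_mulDr : right_distributive (@ualg_mul K A) +%R.
Proof. by move=> a b c; exact: (bilDr (@ualg_mul_bilinear K A)). Qed.

#[non_forgetful_inheritance]
HB.instance Definition _ := GRing.Zmodule_isPzRing.Build A
  (@ualg_mulA K A) (@ualg_mul1l K A) (@ualg_mul1r K A) ualg_mulDl ualg_mulDr.

Lemma ualg_scalerAl (c : K) (a b : A) : c *: (a * b) = (c *: a) * b.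
Proof. by rewrite [RHS](bilZl (@ualg_mul_bilinear K A)). Qed.

Lemma ualg_scalerAr (c : K) (a b : A) : c *: (a * b) = a * (c *: b).
Proof. by rewrite [RHS](bilZr (@ualg_mul_bilinear K A)). Qed.
End UnitalAlgebraRing.

Section TensorAlgebra.
Variables (K : fieldType) (A B : ualgType K).

Definition tens_mul (x y : A ⊗ B) : A ⊗ B :=
  \tsum_(a, b <- x) \tsum_(a', b' <- y) ((a * a') ⊗ (b * b')).

Fact tens_mul_bil2 (a : A) (b : B) :
  bilinear_for *:%R *:%R (fun (a' : A) (b' : B) => (a * a') ⊗ (b * b')).
Proof.
split=> [b' c x y|a' c x y] /=.
  by rewrite mulrDr -ualg_scalerAr (tpure_bilinear _ _).1.
by rewrite mulrDr -ualg_scalerAr (tpure_bilinear _ _).2.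
Qed.

Fact tens_mul_bil1 (y : A ⊗ B) :
  bilinear_for *:%R *:%R
    (fun (a : A) (b : B) => \tsum_(a', b' <- y) ((a * a') ⊗ (b * b'))).
Proof.
split=> [b c x x'|a c x x'] /=.
  rewrite -tsum_comb; apply: eq_tsum => a' b'.
  by rewrite mulrDl -ualg_scalerAl (tpure_bilinear _ _).1.
rewrite -tsum_comb; apply: eq_tsum => a' b'.
by rewrite mulrDl -ualg_scalerAl (tpure_bilinear _ _).2.
Qed.

Fact tens_mul_bilinear : bilinear_for *:%R *:%R tens_mul.
Proof.
split=> [y|x c y y']; first exact/tsum_linear/tens_mul_bil1.
rewrite /tens_mul -tsum_comb; apply: eq_tsum => a b.
by rewrite (tsum_linear (tens_mul_bil2 _ _)).
Qed.

Fact tens_mul_pure (a a' : A) (b b' : B) :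
  tens_mul (a ⊗ b) (a' ⊗ b') = (a * a') ⊗ (b * b').
Proof.
rewrite /tens_mul (tsum_pure (tens_mul_bil1 _)).
by rewrite (tsum_pure (tens_mul_bil2 _ _)).
Qed.

Let mulDl := bilDl tens_mul_bilinear.
Let mulDr := bilDr tens_mul_bilinear.
Let mul0l := bil0l tens_mul_bilinear.
Let mul0r := bil0r tens_mul_bilinear.

Fact tens_mulA : associative tens_mul.
Proof.
move=> x y z; elim/tens_ind: x => [|a b x IHx]; first by rewrite !mul0l.
rewrite !mulDl IHx; congr (_ + _); elim/tens_ind: y {IHx} => [|a' b' y IHy].
  by rewrite !(mul0l, mul0r).
rewrite !(mulDl, mulDr) IHy; congr (_ + _).
elim/tens_ind: z {IHy} => [|a2 b2 z IHz]; first by rewrite !mul0r.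
by rewrite !mulDr IHz !tens_mul_pure !mulrA.
Qed.

Fact tens_mul1l : left_id ((1 : A) ⊗ (1 : B)) tens_mul.
Proof.
elim/tens_ind=> [|a b x IHx]; first by rewrite mul0r.
by rewrite mulDr IHx tens_mul_pure !mul1r.
Qed.

Fact tens_mul1r : right_id ((1 : A) ⊗ (1 : B)) tens_mul.
Proof.
elim/tens_ind=> [|a b x IHx]; first by rewrite mul0l.
by rewrite mulDl IHx tens_mul_pure !mulr1.
Qed.

HB.instance Definition _ := isUnitalAlgebra.Build K (A ⊗ B)%type
  tens_mulA tens_mul1l tens_mul1r tens_mul_bilinear.
HB.instance Definition _ := GRing.PzRing.copy (A ⊗ B)%type
  (A ⊗ B : ualgType K)%type.

Lemma tpureM (a a' : A) (b b' : B) :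
  (a ⊗ b) * (a' ⊗ b') = (a * a') ⊗ (b * b').
Proof. exact: tens_mul_pure. Qed.
End TensorAlgebra.

Structure hopfAlgType (K : fieldType) := HopfAlgebra {
  hopf_sort :> ualgType K;
  comul : {linear hopf_sort -> (hopf_sort ⊗ hopf_sort)%type};
  counit : {scalar hopf_sort};
  antipode : {linear hopf_sort -> hopf_sort};
  comulA : forall h : hopf_sort,
    \tsum_(x, y <- comul h) \tsum_(y1, y2 <- comul y) (x ⊗ y1 ⊗ y2)
    = \tsum_(x, y <- comul h) (comul x ⊗ y);
  comul_counitl : forall h : hopf_sort,
    \tsum_(x, y <- comul h) (counit x *: y) = h;
  comul_counitr : forall h : hopf_sort,
    \tsum_(x, y <- comul h) (counit y *: x) = h;
  comul_monoid : monoid_morphism comul;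
  counit_monoid : monoid_morphism counit;
  antipodel : forall h : hopf_sort,
    \tsum_(x, y <- comul h) (antipode x * y) = counit h *: (1 : hopf_sort);
  antipoder : forall h : hopf_sort,
    \tsum_(x, y <- comul h) (x * antipode y) = counit h *: (1 : hopf_sort);
}.

Arguments comul {K _}.
Arguments counit {K _}.
Arguments antipode {K _}.

(* h_1 ⊗ h_2 ⊗ h_3 *)
Definition comul2 (K : fieldType) (H : hopfAlgType K) (h : H) : H ⊗ H ⊗ H :=
  \tsum_(x, y <- comul h) (comul x ⊗ y).

Section ComoduleAlgebra.
Variables (K : fieldType) (H : hopfAlgType K) (A : ualgType K).

Record comodule_algebra (rho : {linear A -> (A ⊗ H)%type}) : Prop := {
  rho_monoid : monoid_morphism rho;
  rhoA : forall a,
    \tsum_(a0, a1 <- rho a) (rho a0 ⊗ a1)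
    = \tsum_(a0, x <- rho a) \tsum_(a1, a2 <- comul x) (a0 ⊗ a1 ⊗ a2);
  rho_counit : forall a, \tsum_(a0, a1 <- rho a) (counit a1 *: a0) = a;
}.

Variable rho : {linear A -> (A ⊗ H)%type}.

(* a_0 ⊗ a_1 ⊗ a_2 and a_0 ⊗ a_1 ⊗ a_2 ⊗ a_3 *)
Definition rho2 (a : A) : A ⊗ H ⊗ H := \tsum_(x, y <- rho a) (rho x ⊗ y).
Definition rho3 (a : A) : A ⊗ H ⊗ H ⊗ H :=
  \tsum_(x, y <- rho a) (rho2 x ⊗ y).

(* The space underlying A ⊗ H^op is A ⊗ H; every product written below is the
   one of the algebra A ⊗ H (or of A, or of H), never the opposite one. *)

(* psi (h ⊗ a ⊗ l), as a trilinear map *)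
Definition psi (h : H) (a : A) (l : H) : A ⊗ H ⊗ H :=
  \tsum_(a0, a1 <- rho a) \tsum_(l1, l2 <- comul l) (a0 ⊗ l1 ⊗ (l2 * h * a1)).

Record casimir (B : H ⊗ H -> A ⊗ H) : Prop := {
  casimir_linear : linear B;
  casimir_bimodule : forall (a : A) (g h h' : H),
    \tsum_(a0, a1, a2 <- rho2 a) \tsum_(g1, g2, g3 <- comul2 g)
      ((a0 ⊗ (1 : H)) * B ((g2 * h * a1) ⊗ (g3 * h' * a2)) * ((1 : A) ⊗ g1))
    = ((1 : A) ⊗ g) * B (h ⊗ h') * (a ⊗ (1 : H));
  casimir_psi : forall h h' : H,
    \tsum_(h1, h2 <- comul h) \tsum_(b, l <- B (h2 ⊗ h')) psi h1 b l
    = \tsum_(h1', h2' <- comul h') (B (h ⊗ h1') ⊗ h2');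
}.

Definition casimir_normalized (B : H ⊗ H -> A ⊗ H) : Prop :=
  forall h : H,
    \tsum_(h1, h2 <- comul h) B (h1 ⊗ h2) = counit h *: ((1 : A) ⊗ (1 : H)).

Definition h_coseparability (B : H ⊗ H -> A ⊗ H) : Prop :=
  forall h h' h'' : H,
    \tsum_(h1', h2' <- comul h')
      \tsum_(b, l <- B (h ⊗ h1')) \tsum_(c, m <- B (h2' ⊗ h''))
        ((b * c) ⊗ (m * l))
    = counit h' *: B (h ⊗ h'').

Definition h_separable : Prop :=
  exists B : H ⊗ H -> A ⊗ H,
    [/\ casimir B, casimir_normalized B & h_coseparability B].

(* In the integral conditions [Sinv] is the inverse of the antipode. *)
Variable Sinv : H -> H.

Record integral (T : H -> A ⊗ H) : Prop := {
  integral_linear : linear T;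
  integral_psi : forall h : H,
    \tsum_(h1, h2 <- comul h) \tsum_(b, l <- T h2) psi h1 b l = T h ⊗ (1 : H);
  integral_bimodule : forall (a : A) (h : H),
    \tsum_(a0, a1, a2, a3 <- rho3 a)
      ((a0 ⊗ (1 : H)) * T (Sinv a2 * h * a1) * ((1 : A) ⊗ Sinv a3))
    = \tsum_(a0, a1 <- rho a) (((1 : A) ⊗ Sinv a1) * T h * (a0 ⊗ (1 : H)));
}.

Definition integral_total (T : H -> A ⊗ H) : Prop := T 1 = (1 : A) ⊗ (1 : H).

Definition id_counit (x : A ⊗ H) : A := \tsum_(a, h <- x) (counit h *: a).

Definition h_property (T : H -> A ⊗ H) : Prop :=
  forall h h' : H, id_counit (T h * T h') = id_counit (T (h' * h)).

End ComoduleAlgebra.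

Section CanonicalMaps.
Variables (K : fieldType) (H : hopfAlgType K) (A : ualgType K).
Variable Sinv : H -> H.

Definition canonical_casimir (t : H ⊗ H) : A ⊗ H :=
  \tsum_(h, h' <- t) ((1 : A) ⊗ (h' * Sinv h)).

Definition canonical_integral (h : H) : A ⊗ H := (1 : A) ⊗ Sinv h.

End CanonicalMaps.

(* Main.v *)
(* S is an anti-morphism of algebras and of coalgebras (both sides invert the
   product, resp. Delta, for convolution), hence so is S^-1, and the antipode
   axioms become S^-1(h_2) h_1 = eps(h) 1 = h_2 S^-1(h_1).  Substituting
   h' S^-1(h) in each identity then makes the inner legs of the coproducts and
   coactions cancel in pairs. *)
Require Import Defs.
From HB Require Import structures.
From mathcomp Require Import all_boot all_order all_algebra.

Set Implicit Arguments.
Unset Strict Implicit.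
Unset Printing Implicit Defensive.

Import GRing.Theory.

Local Open Scope ring_scope.

(** * Linearity of maps built from scalings, products, pure tensors and Sweedler sums *)

Section LinearMaps.
Variables (K : fieldType) (U V W Z : lmodType K).

Lemma linear_idfun : linear (fun u : U => u).
Proof. by []. Qed.

Lemma linear_app (L : V -> W) (f : U -> V) :
  linear L -> linear f -> linear (fun u => L (f u)).
Proof. by move=> hL hf c u v; rewrite hf hL. Qed.

Lemma linear_scaler c (f : U -> V) : linear f -> linear (fun u => c *: f u).
Proof. by move=> hf a u v; rewrite hf scalerDr !scalerA mulrC. Qed.

Lemma linear_scalel (L : {scalar V}) (f : U -> V) (w : W) :
  linear f -> linear (fun u => L (f u) *: w).
Proof. by move=> hf c u v; rewrite hf linearP scalerDl scalerA. Qed.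

Lemma linear_tpurel (f : U -> V) (w : W) :
  linear f -> linear (fun u => f u ⊗ w).
Proof. by move=> hf c u v; rewrite hf (tpure_bilinear _ _).1. Qed.

Lemma linear_tpurer (f : U -> V) (w : W) :
  linear f -> linear (fun u => w ⊗ f u).
Proof. by move=> hf c u v; rewrite hf (tpure_bilinear _ _).2. Qed.

Lemma bilinearI (f : U -> V -> W) :
  (forall v, linear (fun u => f u v)) -> (forall u, linear (fun v => f u v)) ->
  bilinear_for *:%R *:%R f.
Proof. by move=> fl fr; split=> [v|u]; [exact: fl|exact: fr]. Qed.

(** The variable sits in the tensor: the bilinear summand induces a linear map, which is composed
    with [g]. *)
Lemma linear_tsum_arg (g : Z -> (U ⊗ V)%type) (f : U -> V -> W) :
  linear g ->
  (forall v, linear (fun u => f u v)) -> (forall u, linear (fun v => f u v)) ->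
  linear (fun z => tsum (g z) f).
Proof.
by move=> hg fl fr c x y; rewrite hg (tsum_linear (bilinearI fl fr)).
Qed.

(** The variable sits only in the summand, so one fixed representation of [t] serves all its
    values. *)
Lemma linear_tsum_fun (t : U ⊗ V) (f : Z -> U -> V -> W) :
  (forall u v, linear (fun z => f z u v)) -> linear (fun z => tsum t (f z)).
Proof.
move=> hf c z z'; rewrite -tsum_comb; apply: eq_tsum => u v; exact: hf.
Qed.

Lemma linear_scale (f : U -> V) c u : linear f -> f (c *: u) = c *: f u.
Proof.
move=> hf; pose f' : {linear U -> V} :=
  HB.pack f (GRing.isLinear.Build _ _ _ _ _ hf).
exact: (linearZ_LR f').
Qed.

Lemma linear_tsum (L : W -> Z) (t : U ⊗ V) (f : U -> V -> W) :
  linear L -> L (tsum t f) = \tsum_(u, v <- t) L (f u v).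
Proof.
move=> hL; pose L' : {linear W -> Z} :=
  HB.pack L (GRing.isLinear.Build _ _ _ _ _ hL).
exact: (raddf_sum L').
Qed.

End LinearMaps.

Lemma linear_mull (K : fieldType) (U : lmodType K) (A : ualgType K)
  (f : U -> A) (a : A) : linear f -> linear (fun u => f u * a).
Proof. by move=> hf c u v; rewrite hf mulrDl -ualg_scalerAl. Qed.

Lemma linear_mulr (K : fieldType) (U : lmodType K) (A : ualgType K)
  (f : U -> A) (a : A) : linear f -> linear (fun u => a * f u).
Proof. by move=> hf c u v; rewrite hf mulrDr -ualg_scalerAr. Qed.

(* The function arguments are passed explicitly: left to unification, [tsum]
   would be unfolded to its underlying big operator. *)
Ltac lin_step :=
  match goal with
  | |- forall _, _ => intro
  | |- bilinear_for _ _ _ => refine (bilinearI _ _)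
  | |- linear (fun x => x) => exact: linear_idfun
  | |- linear (fun x => tsum ?t (@?f x)) =>
      refine (linear_tsum_fun t (f := f) _)
  | |- linear (fun x => tsum (@?g x) ?f) =>
      refine (linear_tsum_arg (g := g) (f := f) _ _ _)
  | |- linear (fun x => @?f x * ?a) => refine (linear_mull (f := f) _ _)
  | |- linear (fun x => ?a * @?f x) => refine (linear_mulr (f := f) _ _)
  | |- linear (fun x => @?f x ⊗ ?a) => refine (linear_tpurel (f := f) _ _)
  | |- linear (fun x => ?a ⊗ @?f x) => refine (linear_tpurer (f := f) _ _)
  | |- linear (fun x => ?c *: @?f x) => refine (linear_scaler (f := f) _ _)
  | |- linear (fun x => counit (@?f x) *: ?w) =>
      refine (linear_scalel _ (f := f) _ _)
  | H : forall _, linear _ |- linear _ => exact: H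
  | H : forall _ _, linear _ |- linear _ => exact: H
  | |- linear (fun x => ?L (@?f x)) =>
      refine (linear_app (L := L) (f := f) _ _)
  | |- linear _ => first [assumption | exact: linearP]
  end; cbv beta.

Ltac lin := repeat lin_step.

(** * Calculus of Sweedler sums *)

Section TSum.
Variables (K : fieldType).

Lemma tsum_zero (U V W : lmodType K) (f : U -> V -> W) :
  bilinear_for *:%R *:%R f -> tsum 0 f = 0.
Proof.
by move=> hf; rewrite [0](_ : _ = tens_pi [::]) // tsum_pi // big_nil.
Qed.

Lemma tsumD (U V W : lmodType K) (f : U -> V -> W) s t :
  bilinear_for *:%R *:%R f -> tsum (s + t) f = tsum s f + tsum t f.
Proof. by move=> hf; have := tsum_linear hf 1 s t; rewrite !scale1r. Qed.

Lemma tsum_tpure (U V : lmodType K) (t : U ⊗ V) : \tsum_(u, v <- t) (u ⊗ v) = t.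
Proof.
have bil : bilinear_for *:%R *:%R (fun (u : U) (v : V) => u ⊗ v) by lin.
elim/tens_ind: t => [|u v x IH]; first exact: tsum_zero.
by rewrite tsumD // tsum_pure // IH.
Qed.

Lemma tsum_tsum (U V U' V' W : lmodType K) (t : U ⊗ V)
  (g : U -> V -> (U' ⊗ V')%type) (f : U' -> V' -> W) :
  bilinear_for *:%R *:%R f ->
  tsum (tsum t g) f = \tsum_(u, v <- t) tsum (g u v) f.
Proof.
move=> hf; apply: (linear_tsum (L := fun t => tsum t f)).
exact: tsum_linear.
Qed.

Lemma tsum_mul (A B : ualgType K) (W : lmodType K) (s t : A ⊗ B)
  (f : A -> B -> W) : bilinear_for *:%R *:%R f ->
  tsum (s * t) f = \tsum_(a, b <- s) \tsum_(a', b' <- t) f (a * a') (b * b').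
Proof.
move=> hf; rewrite [s * t]/(tens_mul s t) tsum_tsum //; apply: eq_tsum => a b.
by rewrite tsum_tsum //; apply: eq_tsum => a' b'; rewrite tsum_pure.
Qed.

Lemma exchange_tsum (U V U' V' W : lmodType K) (s : U ⊗ V) (t : U' ⊗ V')
  (f : U -> V -> U' -> V' -> W) :
  \tsum_(u, v <- s) \tsum_(x, y <- t) f u v x y
  = \tsum_(x, y <- t) \tsum_(u, v <- s) f u v x y.
Proof. exact: exchange_big. Qed.

(** Guarantees that a Sweedler sum over a threefold tensor does not depend on the chosen
    representatives. *)
Definition trilinear (U V W Z : lmodType K) (f : U -> V -> W -> Z) : Prop :=
  [/\ forall v w, linear (fun u => f u v w),
      forall u w, linear (fun v => f u v w)
    & forall u v, linear (fun w => f u v w)].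

Lemma tsum3_tsum (U V W U' V' Z : lmodType K) (f : U -> V -> W -> Z)
  (t : U' ⊗ V') (g : U' -> V' -> (U ⊗ V ⊗ W)%type) : trilinear f ->
  \tsum_(x, y, z <- tsum t g) f x y z
  = \tsum_(u, v <- t) \tsum_(x, y, z <- g u v) f x y z.
Proof. by case=> f1 f2 f3; rewrite tsum_tsum //; lin. Qed.

Lemma tsum3_tpure (U V W Z : lmodType K) (f : U -> V -> W -> Z) t w :
  trilinear f ->
  \tsum_(x, y, z <- t ⊗ w) f x y z = \tsum_(x, y <- t) f x y w.
Proof. by case=> f1 f2 f3; rewrite tsum_pure //; lin. Qed.

(** [comul2] and [rho2] have this shape: the first leg of a coproduct or coaction is expanded once
    more. *)
Lemma tsum_tpurel (U V W U' Z : lmodType K) (f : U -> V -> W -> Z)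
  (t : U' ⊗ W) (g : U' -> (U ⊗ V)%type) : trilinear f ->
  \tsum_(x, y, z <- tsum t (fun u w => g u ⊗ w)) f x y z
  = \tsum_(u, w <- t) \tsum_(x, y <- g u) f x y w.
Proof.
by move=> hf; rewrite tsum3_tsum //; apply: eq_tsum => u w; rewrite tsum3_tpure.
Qed.

End TSum.

(** * Hopf algebra identities under the Sweedler sum; the antipode as an anti-morphism *)

Section HopfAlgebra.
Variables (K : fieldType) (H : hopfAlgType K).
Implicit Types (g h : H) (W : lmodType K) (C : ualgType K).
Local Notation S := (antipode : H -> H).
Local Notation eps := (@counit K H).

(** Coassociativity pushed through the linear map on [H ⊗ H ⊗ H] induced by [f]. *)
Lemma comul_coassoc W (f : H -> H -> H -> W) h : trilinear f ->
  \tsum_(x, y <- comul h) \tsum_(y1, y2 <- comul y) f x y1 y2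
  = \tsum_(x, y <- comul h) \tsum_(x1, x2 <- comul x) f x1 x2 y.
Proof.
move=> hf; rewrite -tsum_tpurel // -comulA tsum3_tsum //.
apply: eq_tsum => x y; rewrite tsum3_tsum //; apply: eq_tsum => y1 y2.
by rewrite tsum3_tpure //; case: hf => f1 f2 f3; rewrite tsum_pure //; lin.
Qed.

Lemma tsum_comul2 W (f : H -> H -> H -> W) h : trilinear f ->
  \tsum_(x, y, z <- comul2 h) f x y z
  = \tsum_(x, z <- comul h) \tsum_(x1, x2 <- comul x) f x1 x2 z.
Proof. exact: tsum_tpurel. Qed.

Lemma tsum_counitl W (f : H -> W) h : linear f ->
  \tsum_(x, y <- comul h) (eps x *: f y) = f h.
Proof.
move=> hf; rewrite -[in RHS](comul_counitl h) linear_tsum //.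
by apply: eq_tsum => x y; rewrite linear_scale.
Qed.

Lemma tsum_counitr W (f : H -> W) h : linear f ->
  \tsum_(x, y <- comul h) (eps y *: f x) = f h.
Proof.
move=> hf; rewrite -[in RHS](comul_counitr h) linear_tsum //.
by apply: eq_tsum => x y; rewrite linear_scale.
Qed.

Lemma tsum_antipodel W (f : H -> W) h : linear f ->
  \tsum_(x, y <- comul h) f (S x * y) = eps h *: f 1.
Proof. by move=> hf; rewrite -linear_tsum // antipodel linear_scale. Qed.

Lemma tsum_antipoder W (f : H -> W) h : linear f ->
  \tsum_(x, y <- comul h) f (x * S y) = eps h *: f 1.
Proof. by move=> hf; rewrite -linear_tsum // antipoder linear_scale. Qed.

Lemma tsum_comulM W (f : H -> H -> W) g h : bilinear_for *:%R *:%R f ->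
  \tsum_(x, y <- comul (g * h)) f x y
  = \tsum_(h1, h2 <- comul h) \tsum_(g1, g2 <- comul g) f (g1 * h1) (g2 * h2).
Proof. by move=> hf; rewrite (comul_monoid H).2 tsum_mul // exchange_tsum. Qed.

Lemma tsum_comul1 W (f : H -> H -> W) : bilinear_for *:%R *:%R f ->
  \tsum_(x, y <- comul (1 : H)) f x y = f 1 1.
Proof. by move=> hf; rewrite (comul_monoid H).1 tsum_pure. Qed.

Lemma counit1 : eps 1 = 1.
Proof. exact: (counit_monoid H).1. Qed.

Lemma counitM g h : eps (g * h) = eps g * eps h.
Proof. exact: (counit_monoid H).2. Qed.

Lemma convolution_cancel C (f phi psi : H -> C) (c : C) :
  linear f -> linear phi -> linear psi ->
  (forall h, \tsum_(x, y <- comul h) (phi x * psi y) = eps h *: (1 : C)) ->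
  (forall h, \tsum_(x, y <- comul h) (f x * phi y) = eps h *: c) ->
  forall h, f h = c * psi h.
Proof.
(* f = f * (phi * psi) = (f * phi) * psi for the convolution product. *)
move=> hf hphi hpsi phipsi fphi h; rewrite -(tsum_counitr _ hf).
transitivity (\tsum_(x, y <- comul h) \tsum_(y1, y2 <- comul y)
    (f x * phi y1 * psi y2)).
  apply: eq_tsum => x y.
  rewrite -[f x in LHS]mulr1 ualg_scalerAr -phipsi.
  rewrite (linear_tsum (L := fun z => f x * z)); last by lin.
  by apply: eq_tsum => y1 y2; rewrite mulrA.
rewrite (comul_coassoc (f := fun x y z => f x * phi y * psi z));
  last by split; lin.
rewrite -(tsum_counitl (f := fun h => c * psi h)); last by lin.
apply: eq_tsum => x y.
rewrite -(linear_tsum (L := fun z : C => z * psi y)); last by lin.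
by rewrite fphi ualg_scalerAl.
Qed.

Lemma antipode1 : S 1 = 1.
Proof.
have := antipodel (1 : H); rewrite tsum_comul1; last by lin.
by rewrite counit1 scale1r mulr1.
Qed.

(* Obtained by cancelling k_2 in S(g_1 k_1) g_2 k_2 = eps(g) eps(k) 1; cancelling
   g_2 in turn gives [antipodeM]. *)
Lemma antipodeM_partial g k :
  \tsum_(g1, g2 <- comul g) (S (g1 * k) * g2) = eps g *: S k.
Proof.
rewrite -[S k]mul1r ualg_scalerAl.
apply: (convolution_cancel (phi := fun x => x)
  (f := fun k => \tsum_(g1, g2 <- comul g) (S (g1 * k) * g2))); try by lin.
  exact: antipoder.
move=> h; rewrite scalerA mulrC -counitM -antipodel tsum_comulM; last by lin.
apply: eq_tsum => h1 h2.
rewrite (linear_tsum (L := fun z : H => z * h2)); last by lin.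
by apply: eq_tsum => g1 g2; rewrite mulrA.
Qed.

Lemma antipodeM g h : S (g * h) = S h * S g.
Proof.
apply: (convolution_cancel (f := fun g => S (g * h)) (phi := fun x => x)
  (psi := S)); try by lin.
  exact: antipoder.
by move=> x; exact: antipodeM_partial.
Qed.

(** In the convolution algebra of maps from [H] to [H ⊗ H], the left side is a left inverse of
    [comul] and the right side a right inverse. *)
Lemma antipode_comul h :
  comul (S h) = \tsum_(x, y <- comul h) (S y ⊗ S x).
Proof.
rewrite -[RHS]mul1r.
apply: (convolution_cancel (C := (H ⊗ H)%type) (phi := comul)
  (f := fun h => comul (S h))
  (psi := fun h => \tsum_(x, y <- comul h) (S y ⊗ S x))); try by lin.
- move=> {}h.
  (* The convolution of [comul] with the right side is h_1 S(h_4) ⊗ h_2 S(h_3): the inner pair h_2,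
     h_3 cancels first, then the outer one. *)
  transitivity (\tsum_(x, y <- comul h) \tsum_(x1, x2 <- comul x)
      \tsum_(y1, y2 <- comul y) ((x1 * S y2) ⊗ (x2 * S y1))).
    apply: eq_tsum => x y; rewrite -[comul x in LHS]tsum_tpure.
    rewrite (linear_tsum (L := fun z : (H ⊗ H)%type => z * _)); last by lin.
    apply: eq_tsum => x1 x2.
    rewrite (linear_tsum (L := fun z : (H ⊗ H)%type => (x1 ⊗ x2) * z));
      last by lin.
    by apply: eq_tsum => y1 y2; rewrite tpureM.
  rewrite -(comul_coassoc (f := fun x1 x2 y => \tsum_(y1, y2 <- comul y)
      ((x1 * S y2) ⊗ (x2 * S y1)))); last by split; lin.
  transitivity (\tsum_(x, y <- comul h) ((x * S y) ⊗ (1 : H))).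
    apply: eq_tsum => x y.
    rewrite (comul_coassoc (f := fun u v1 v2 => (x * S v2) ⊗ (u * S v1)));
      last by split; lin.
    rewrite -(tsum_counitl (f := fun y => (x * S y) ⊗ (1 : H))); last by lin.
    apply: eq_tsum => u v.
    by rewrite (tsum_antipoder (f := fun z => (x * S v) ⊗ z)) //; lin.
  by rewrite (tsum_antipoder (f := fun z => z ⊗ (1 : H))) //; lin.
(* Left inverse: multiplicativity of [comul] merges Delta(S(x_1)) Delta(x_2) into Delta(S(x_1)
   x_2). *)
move=> x; rewrite -[1]/((1 : H) ⊗ (1 : H)).
have -> : (1 : H) ⊗ (1 : H) = comul (1 : H) by rewrite (comul_monoid H).1.
rewrite -(tsum_antipodel (f := fun z => comul z)); last by lin.
by apply: eq_tsum => x1 x2; rewrite (comul_monoid H).2.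
Qed.

(** * The inverse antipode *)

Section InverseAntipode.
Variable Sinv : {linear H -> H}.
Hypotheses (antipodeK : cancel S Sinv) (SinvK : cancel Sinv S).

Lemma Sinv1 : Sinv 1 = 1.
Proof. by rewrite -{1}antipode1 antipodeK. Qed.

Lemma SinvM g h : Sinv (g * h) = Sinv h * Sinv g.
Proof. by apply: (can_inj antipodeK); rewrite antipodeM !SinvK. Qed.

Lemma Sinv_comul h :
  comul (Sinv h) = \tsum_(x, y <- comul h) (Sinv y ⊗ Sinv x).
Proof.
(* With the right-hand [h] written as [S (Sinv h)], [antipode_comul] expands it; [Sinv] undoes [S]
   on each leg and the two flips cancel. *)
rewrite -{2}[h]SinvK antipode_comul tsum_tsum; last by lin.
rewrite -[LHS]tsum_tpure; apply: eq_tsum => x y.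
by rewrite tsum_pure ?antipodeK //; lin.
Qed.

(** [Sinv] reverses products, so it turns [S x * y] in the antipode axiom into [Sinv y * x]. *)
Lemma tsum_Sinvl W (f : H -> W) h : linear f ->
  \tsum_(x, y <- comul h) f (Sinv y * x) = eps h *: f 1.
Proof.
move=> hf; rewrite -{1}Sinv1.
rewrite -(tsum_antipodel (f := fun z => f (Sinv z))); last by lin.
by apply: eq_tsum => x y; rewrite SinvM antipodeK.
Qed.

Lemma tsum_Sinvr W (f : H -> W) h : linear f ->
  \tsum_(x, y <- comul h) f (y * Sinv x) = eps h *: f 1.
Proof.
move=> hf; rewrite -{1}Sinv1.
rewrite -(tsum_antipoder (f := fun z => f (Sinv z))); last by lin.
by apply: eq_tsum => x y; rewrite SinvM antipodeK.
Qed.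

(** * Coactions and the map [psi] *)

Section ComoduleAlgebra.
Variables (A : ualgType K) (rho : {linear A -> (A ⊗ H)%type}).
Hypothesis rho_coact : comodule_algebra rho.

Lemma tsum_rho1 W (f : A -> H -> W) : bilinear_for *:%R *:%R f ->
  \tsum_(a0, a1 <- rho 1) f a0 a1 = f 1 1.
Proof. by move=> hf; rewrite (rho_monoid rho_coact).1 tsum_pure. Qed.

Lemma tsum_rho_counit W (f : A -> W) a : linear f ->
  \tsum_(a0, a1 <- rho a) (eps a1 *: f a0) = f a.
Proof.
move=> hf; rewrite -[in RHS](rho_counit rho_coact a) linear_tsum //.
by apply: eq_tsum => x y; rewrite linear_scale.
Qed.

(** Coassociativity of the coaction makes a_1 ⊗ a_2 the coproduct of a single leg, the form in which
    [Sinv] can contract them. *)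
Lemma tsum_rho2 W (f : A -> H -> H -> W) a : trilinear f ->
  \tsum_(a0, a1, a2 <- rho2 rho a) f a0 a1 a2
  = \tsum_(a0, x <- rho a) \tsum_(a1, a2 <- comul x) f a0 a1 a2.
Proof.
move=> hf; rewrite [rho2 rho a](rhoA rho_coact) tsum3_tsum //.
apply: eq_tsum => x y; rewrite tsum3_tsum //; apply: eq_tsum => y1 y2.
by rewrite tsum3_tpure //; case: hf => f1 f2 f3; rewrite tsum_pure //; lin.
Qed.

Lemma tsum_rhoA W (f : A -> H -> H -> W) a : trilinear f ->
  \tsum_(x, a2 <- rho a) \tsum_(a0, a1 <- rho x) f a0 a1 a2
  = \tsum_(a0, x <- rho a) \tsum_(a1, a2 <- comul x) f a0 a1 a2.
Proof. by move=> hf; rewrite -tsum_rho2 // [RHS]tsum_tpurel. Qed.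

(** The canonical maps have [A]-component 1, so this is the only case of [psi] that they meet. *)
Lemma psi1 h l :
  psi rho h 1 l = \tsum_(l1, l2 <- comul l) ((1 : A) ⊗ l1 ⊗ (l2 * h)).
Proof.
rewrite /psi tsum_rho1; last by lin.
by apply: eq_tsum => l1 l2; rewrite mulr1.
Qed.

(** * The canonical Casimir morphism *)

Local Notation B := (canonical_casimir A Sinv).
Local Notation T := (canonical_integral A Sinv).

Lemma canonical_casimir_linear : linear B.
Proof. by apply: tsum_linear; lin. Qed.

Lemma canonical_casimirE h h' : B (h ⊗ h') = (1 : A) ⊗ (h' * Sinv h).
Proof. by rewrite /canonical_casimir tsum_pure //; lin. Qed.

Lemma canonical_casimir_bimodule a g h h' :
  \tsum_(a0, a1, a2 <- rho2 rho a) \tsum_(g1, g2, g3 <- comul2 g)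
    ((a0 ⊗ (1 : H)) * B ((g2 * h * a1) ⊗ (g3 * h' * a2)) * ((1 : A) ⊗ g1))
  = ((1 : A) ⊗ g) * B (h ⊗ h') * (a ⊗ (1 : H)).
Proof.
rewrite canonical_casimirE !tpureM !mul1r mulr1.
(* The left side is a_0 ⊗ g_3 h' a_2 S^-1(a_1) S^-1(h) S^-1(g_2) g_1. The pair S^-1(g_2) g_1 is
   contracted here, a_2 S^-1(a_1) afterwards. *)
transitivity (\tsum_(a0, a1, a2 <- rho2 rho a)
    (a0 ⊗ (g * (h' * (a2 * Sinv a1) * Sinv h)))).
  apply: eq_tsum => a01 a2; apply: eq_tsum => a0 a1.
  transitivity (\tsum_(g1, g2, g3 <- comul2 g)
      (a0 ⊗ (g3 * (h' * (a2 * Sinv a1) * Sinv h) * (Sinv g2 * g1)))).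
    apply: eq_tsum => g12 g3; apply: eq_tsum => g1 g2.
    by rewrite canonical_casimirE !tpureM !mulr1 mul1r !SinvM !mulrA.
  rewrite tsum_comul2; last by split; lin.
  rewrite -(tsum_counitl
    (f := fun y => a0 ⊗ (y * (h' * (a2 * Sinv a1) * Sinv h)))); last by lin.
  apply: eq_tsum => x y; rewrite (tsum_Sinvl (f := fun z =>
    a0 ⊗ (y * (h' * (a2 * Sinv a1) * Sinv h) * z))) ?mulr1 //; lin.
rewrite tsum_rho2; last by split; lin.
rewrite -(tsum_rho_counit (f := fun a0 => a0 ⊗ (g * (h' * Sinv h))));
  last by lin.
apply: eq_tsum => a0 x.
by rewrite (tsum_Sinvr (f := fun z => a0 ⊗ (g * (h' * z * Sinv h))))
  ?mulr1 //; lin.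
Qed.

Lemma tsum_canonical_casimir W (f : A -> H -> W) h h' :
  bilinear_for *:%R *:%R f ->
  \tsum_(b, l <- B (h ⊗ h')) f b l = f 1 (h' * Sinv h).
Proof. by move=> hf; rewrite canonical_casimirE tsum_pure. Qed.

Lemma canonical_casimir_psi h h' :
  \tsum_(h1, h2 <- comul h) \tsum_(b, l <- B (h2 ⊗ h')) psi rho h1 b l
  = \tsum_(h1', h2' <- comul h') (B (h ⊗ h1') ⊗ h2').
Proof.
(* Since S^-1 flips the coproduct, [psi] yields 1 ⊗ h'_1 S^-1(h_3) ⊗ h'_2 S^-1(h_2) h_1. *)
transitivity (\tsum_(h1', h2' <- comul h') \tsum_(h1, h2 <- comul h)
    \tsum_(x, y <- comul h2)
      ((1 : A) ⊗ (h1' * Sinv y) ⊗ (h2' * (Sinv x * h1)))).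
  rewrite -exchange_tsum; apply: eq_tsum => h1 h2.
  rewrite tsum_canonical_casimir; last by rewrite /psi; lin.
  rewrite psi1 tsum_comulM; last by lin.
  rewrite Sinv_comul tsum_tsum; last by lin.
  rewrite -[RHS]exchange_tsum; apply: eq_tsum => x y.
  rewrite tsum_pure; last by lin.
  by apply: eq_tsum => h1' h2'; rewrite mulrA.
apply: eq_tsum => h1' h2'.
(* Regrouping makes h_1 ⊗ h_2 the coproduct of one leg, so that S^-1(h_2) h_1 contracts. *)
rewrite (comul_coassoc (f := fun h1 x y =>
  (1 : A) ⊗ (h1' * Sinv y) ⊗ (h2' * (Sinv x * h1)))); last by split; lin.
rewrite canonical_casimirE.
rewrite -(tsum_counitl (f := fun y => (1 : A) ⊗ (h1' * Sinv y) ⊗ h2'));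
  last by lin.
apply: eq_tsum => x y.
by rewrite (tsum_Sinvl (f := fun z => (1 : A) ⊗ (h1' * Sinv y) ⊗ (h2' * z)))
  ?mulr1 //; lin.
Qed.

Lemma canonical_casimirP : casimir rho B.
Proof.
split; [exact: canonical_casimir_linear | exact: canonical_casimir_bimodule
  | exact: canonical_casimir_psi].
Qed.

(** This is h_2 S^-1(h_1) = eps(h) 1, placed in the second leg. *)
Lemma canonical_casimir_normalized : casimir_normalized B.
Proof.
move=> h; rewrite -(tsum_Sinvr (f := fun z => (1 : A) ⊗ z)); last by lin.
by apply: eq_tsum => x y; rewrite canonical_casimirE.
Qed.

Lemma canonical_casimir_h_coseparability : h_coseparability B.
Proof.
(* The inserted 1 is the slot where eps(h') 1 is expanded as S^-1(h'_2) h'_1; the reversed product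
   [m * l] produces exactly h'' S^-1(h'_2) h'_1 S^-1(h). *)
move=> h h' h''; rewrite canonical_casimirE -[Sinv h]mul1r.
rewrite -(tsum_Sinvl (f := fun z => (1 : A) ⊗ (h'' * (z * Sinv h))));
  last by lin.
apply: eq_tsum => x y; rewrite !tsum_canonical_casimir; try by lin.
by rewrite mul1r !mulrA.
Qed.

(** * The canonical integral *)

Lemma canonical_integralE h : T h = B (h ⊗ (1 : H)).
Proof. by rewrite canonical_casimirE mul1r. Qed.

(** The case h' = 1 of [canonical_casimir_psi], as Delta(1) = 1 ⊗ 1. *)
Lemma canonical_integral_psi h :
  \tsum_(h1, h2 <- comul h) \tsum_(b, l <- T h2) psi rho h1 b l
  = T h ⊗ (1 : H).
Proof.
under eq_tsum => h1 h2 do rewrite canonical_integralE.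
rewrite canonical_casimir_psi tsum_comul1 ?canonical_integralE //.
by have := canonical_casimir_linear; lin.
Qed.

Lemma canonical_integral_bimodule a h :
  \tsum_(a0, a1, a2, a3 <- rho3 rho a)
    ((a0 ⊗ (1 : H)) * T (Sinv a2 * h * a1) * ((1 : A) ⊗ Sinv a3))
  = \tsum_(a0, a1 <- rho a) (((1 : A) ⊗ Sinv a1) * T h * (a0 ⊗ (1 : H))).
Proof.
(* S^-1(S^-1(a_2)) S^-1(a_3) folds into S^-1(a_3 S^-1(a_2)), which exposes the product that
   [tsum_Sinvr] contracts. *)
transitivity (\tsum_(a0, a1, a2, a3 <- rho3 rho a)
    (a0 ⊗ (Sinv a1 * Sinv h * Sinv (a3 * Sinv a2)))).
  apply: eq_tsum => t a3; apply: eq_tsum => t' a2; apply: eq_tsum => a0 a1.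
  by rewrite /canonical_integral !tpureM !mulr1 mul1r !SinvM !mulrA.
rewrite [LHS](tsum_tpurel (f := fun u (a2 a3 : H) => \tsum_(a0, a1 <- u)
    (a0 ⊗ (Sinv a1 * Sinv h * Sinv (a3 * Sinv a2))))); last by split; lin.
transitivity (\tsum_(x, a3 <- rho a) \tsum_(u, a2 <- rho x)
    \tsum_(a0, a1 <- rho u) (a0 ⊗ (Sinv a1 * Sinv h * Sinv (a3 * Sinv a2)))).
  by apply: eq_tsum => x a3; rewrite [LHS]tsum_tpurel //; split; lin.
(* Only the two outer coactions are regrouped, turning a_2 ⊗ a_3 into a coproduct; the innermost one
   survives as the coaction on the right side. *)
rewrite (tsum_rhoA (f := fun u (a2 a3 : H) => \tsum_(a0, a1 <- rho u)
    (a0 ⊗ (Sinv a1 * Sinv h * Sinv (a3 * Sinv a2))))); last by split; lin.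
transitivity (\tsum_(a0, a1 <- rho a) (a0 ⊗ (Sinv a1 * Sinv h))); last first.
  apply: eq_tsum => a0 a1.
  by rewrite /canonical_integral !tpureM !mul1r mulr1.
rewrite -(tsum_rho_counit
  (f := fun u => \tsum_(a0, a1 <- rho u) (a0 ⊗ (Sinv a1 * Sinv h))));
  last by lin.
apply: eq_tsum => u x; rewrite exchange_tsum.
rewrite [RHS](linear_tsum (L := fun z => eps x *: z)); last by lin.
apply: eq_tsum => a0 a1.
rewrite (tsum_Sinvr (f := fun z => a0 ⊗ (Sinv a1 * Sinv h * Sinv z)));
  last by lin.
by rewrite Sinv1 mulr1.
Qed.

Lemma canonical_integralP : integral rho Sinv T.
Proof.
split; [by rewrite /canonical_integral; lin | exact: canonical_integral_psi
  | exact: canonical_integral_bimodule].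
Qed.

Lemma canonical_integral_total : integral_total T.
Proof. by rewrite /integral_total /canonical_integral Sinv1. Qed.

(** Already [T h * T h' = T (h' * h)], because S^-1 reverses products; [id_counit] is then applied
    to equal elements. *)
Lemma canonical_integral_h_property : h_property T.
Proof.
by move=> h h'; rewrite /canonical_integral tpureM mul1r SinvM.
Qed.

End ComoduleAlgebra.
End InverseAntipode.
End HopfAlgebra.

Theorem proposition3p10 (K : fieldType) (H : hopfAlgType K) (A : ualgType K)
    (rho : {linear A -> (A ⊗ H)%type}) (rho_coact : comodule_algebra rho)
    (Sinv : H -> H)
    (antipodeK : cancel (antipode : H -> H) Sinv)
    (SinvK : cancel Sinv (antipode : H -> H)) :
  let B : H ⊗ H -> A ⊗ H := canonical_casimir A Sinv in
  let T : H -> A ⊗ H := canonical_integral A Sinv in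
  [/\ forall h h' : H, B (h ⊗ h') = (1 : A) ⊗ (h' * Sinv h),
      [/\ casimir rho B, casimir_normalized B & h_coseparability B],
      forall h : H, T h = B (h ⊗ (1 : H)),
      [/\ integral rho Sinv T, integral_total T & h_property T]
    & h_separable rho].
Proof.
(* The lemmas above take a bundled linear [Sinv]; the inverse of a bijective linear map is linear,
   so the given function can be packed as one. *)
have Sinv_linear : linear Sinv by apply: can2_linear antipodeK SinvK.
pose S' : {linear H -> H} :=
  HB.pack Sinv (GRing.isLinear.Build _ _ _ _ _ Sinv_linear).
move=> B T.
have casB : [/\ casimir rho B, casimir_normalized B & h_coseparability B].
  split; [exact: (@canonical_casimirP _ _ S')
    | exact: (@canonical_casimir_normalized _ _ S')
    | exact: (@canonical_casimir_h_coseparability _ _ S')].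
split=> //.
- exact: (@canonical_casimirE _ _ S').
- exact: (@canonical_integralE _ _ S').
- split; [exact: (@canonical_integralP _ _ S')
    | exact: (@canonical_integral_total _ _ S')
    | exact: (@canonical_integral_h_property _ _ S')].
- by exists B.
Qed.
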